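(* Consider the critical Kohn-Laplace equation $$u_{xx}+u_{yy}+4(x^{2}+y^{2})u_{tt}+4yu_{xt}-4xu_{yt}+u^{3}=0,\qquad u=u(x,y,t)\in\mathbb{R},$$ and its Noether symmetries $T,R,\tilde X,\tilde Y,Z,V_1,V_2,V_3$ (vector fields listed in the context). The conservation laws of these Noether symmetries, given by Noether's theorem and holding for all solutions $u$ of the equation, are the following, where $\mathrm{Div}(P)=D_xP_1+D_yP_2+D_tP_3$ for $P=(P_1,P_2,P_3)$. 1. For the symmetry $T$, the conservation law is $\mathrm{Div}(\tau)=0$, where $\tau=(\tau_1,\tau_2,\tau_3)$ and $$\tau_1=-2yu_t^2-u_xu_t,\qquad \tau_2=2xu_t^2-u_yu_t,$$ $$\tau_3=\tfrac12u_x^2+\tfrac12u_y^2-2(x^2+y^2)u_t^2-\tfrac14u^4.$$ 2. For the symmetry $R$, the conservation law is $\mathrm{Div}(\sigma)=0$, where $\sigma=(\sigma_1,\sigma_2,\sigma_3)$ and $$\sigma_1=-\tfrac12yu_x^2+\tfrac12yu_y^2+2y(x^2+y^2)u_t^2+xu_xu_y-\tfrac14yu^4,$$ $$\sigma_2=-\tfrac12xu_x^2+\tfrac12xu_y^2-2x(x^2+y^2)u_t^2-yu_xu_y+\tfrac14xu^4,$$ $$\sigma_3=-2y^2u_x^2-2x^2u_y^2+4xyu_xu_y-4y(x^2+y^2)u_xu_t+4x(x^2+y^2)u_yu_t.$$ 3. For the symmetry $\tilde X$, the conservation law is $\mathrm{Div}(\chi)=0$, where $\chi=(\chi_1,\chi_2,\chi_3)$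 and $$\chi_1=-\tfrac12u_x^2+\tfrac12u_y^2+2(x^2+3y^2)u_t^2+2yu_xu_t-2xu_yu_t-\tfrac14u^4,$$ $$\chi_2=-4xyu_t^2-u_xu_y+2xu_xu_t+2yu_yu_t,$$ $$\chi_3=-3yu_x^2-yu_y^2+4y(x^2+y^2)u_t^2+2xu_xu_y-4(x^2+y^2)u_xu_t+\tfrac12yu^4.$$ 4. For the symmetry $\tilde Y$, the conservation law is $\mathrm{Div}(\upsilon)=0$, where $\upsilon=(\upsilon_1,\upsilon_2,\upsilon_3)$ and $$\upsilon_1=-4xyu_t^2-u_xu_y-2xu_xu_t-2yu_yu_t,$$ $$\upsilon_2=\tfrac12u_x^2-\tfrac12u_y^2+2(3x^2+y^2)u_t^2+2yu_xu_t-2xu_yu_t-\tfrac14u^4,$$ $$\upsilon_3=xu_x^2+3xu_y^2-4x(x^2+y^2)u_t^2-2yu_xu_y-4(x^2+y^2)u_yu_t-\tfrac12xu^4.$$ 5. For the symmetry $Z$, the conservation law is $\mathrm{Div}(\zeta)=0$, where $\zeta=(\zeta_1,\zeta_2,\zeta_3)$ and $$\zeta_1=-\tfrac12xu_x^2+\tfrac12xu_y^2+2(x^3-2ty+xy^2)u_t^2-yu_xu_y-2tu_xu_t-2(x^2+y^2)u_yu_t-uu_x-2yuu_t-\tfrac14xu^4,$$ $$\zeta_2=\tfrac12yu_x^2-\tfrac12yu_y^2+2(2tx+x^2y+y^3)u_t^2-xu_xu_y+2(x^2+y^2)u_xu_t-2tu_yu_t-uu_y+2xuu_t-\tfrac14yu^4,$$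 $$\zeta_3=(t-2xy)u_x^2+(t+2xy)u_y^2-4t(x^2+y^2)u_t^2+2(x^2-y^2)u_xu_y-4x(x^2+y^2)u_xu_t-4y(x^2+y^2)u_yu_t+2xuu_y-2yuu_x-4(x^2+y^2)uu_t-\tfrac12tu^4.$$ 6. For the symmetry $V_1$, the conservation law is $\mathrm{Div}(A)=0$, where $A=(A_1,A_2,A_3)$ and $$A_1=-\tfrac12(tx-x^2y-y^3)u_x^2+\tfrac12(tx-x^2y-y^3)u_y^2+2t(x^3+xy^2-ty)u_t^2-(x^3+xy^2+ty)u_xu_y-[t^2-(x^2+y^2)^2]u_xu_t-2t(x^2+y^2)u_yu_t-tuu_x-2tyuu_t+yu^2-\tfrac14(tx-x^2y-y^3)u^4,$$ $$A_2=\tfrac12(x^3+ty+xy^2)u_x^2-\tfrac12(x^3+ty+xy^2)u_y^2+2t(x^2y+y^3+tx)u_t^2-(tx-x^2y-y^3)u_xu_y+2t(x^2+y^2)u_xu_t-[t^2-(x^2+y^2)^2]u_yu_t-tuu_y+2txuu_t-xu^2-\tfrac14(x^3+ty+xy^2)u^4,$$ $$A_3=\tfrac12(t^2-x^4-4txy+2x^2y^2+3y^4)u_x^2+\tfrac12(t^2+3x^4+4txy+2x^2y^2-y^4)u_y^2-2(x^2+y^2)[t^2-(x^2+y^2)^2]u_t^2+2[t(x^2-y^2)-2xy(x^2+y^2)]u_xu_y-4(x^2+y^2)(tx-x^2y-y^3)u_xu_t-4(x^2+y^2)(x^3+ty+xy^2)u_yu_t-2tyuu_x+2txuu_y-4t(x^2+y^2)uu_t+2(x^2+y^2)u^2-\tfrac14[t^2-(x^2+y^2)^2]u^4.$$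 7. For the symmetry $V_2$, the conservation law is $\mathrm{Div}(B)=0$, where $B=(B_1,B_2,B_3)$ and $$B_1=-\tfrac12(t-4xy)u_x^2+\tfrac12(t-4xy)u_y^2+[2t(x^2+3y^2)-4xy(x^2+y^2)]u_t^2-(3x^2-y^2)u_xu_y+2(x^3+ty+xy^2)u_xu_t-2(tx-x^2y-y^3)u_yu_t+2yuu_x+4y^2uu_t-\tfrac14(t-4xy)u^4,$$ $$B_2=\tfrac12(3x^2-y^2)u_x^2-\tfrac12(3x^2-y^2)u_y^2+2(x^4-2txy-y^4)u_t^2-(t-4xy)u_xu_y+2(tx-x^2y-y^3)u_xu_t+2(x^3+ty+xy^2)u_yu_t+2yuu_y-4xyuu_t-u^2-\tfrac14(3x^2-y^2)u^4,$$ $$B_3=(7xy^2-x^3-3ty)u_x^2+(5x^3-3xy^2-ty)u_y^2+4(x^2+y^2)(x^3+ty+xy^2)u_t^2+2(tx-7x^2y+y^3)u_xu_y-4(t-4xy)(x^2+y^2)u_xu_t-4(3x^4+2x^2y^2-y^4)u_yu_t+2xu^2+4y^2uu_x-4xyuu_y+8y(x^2+y^2)uu_t+\tfrac12(x^3+ty+xy^2)u^4.$$ 8. For the symmetry $V_3$, the conservation law is $\mathrm{Div}(C)=0$, where $C=(C_1,C_2,C_3)$ and $$C_1=\tfrac12(x^2y-tx+y^3)u_x^2+\tfrac12(tx-x^2y-y^3)u_y^2+2t(x^3-ty+xy^2)u_t^2-(x^3+ty+xy^2)u_xu_y-[t^2-(x^2+y^2)^2]u_xu_t-2t(x^2+y^2)u_yu_t-tuu_x-2tyuu_t-\tfrac14(tx-x^2y-y^3)u^4,$$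 $$C_2=\tfrac12(x^3+ty+xy^2)u_x^2-\tfrac12(x^3+ty+xy^2)u_y^2+2t(tx+x^2y+y^3)u_t^2-(tx-x^2y-y^3)u_xu_y+2t(x^2+y^2)u_xu_t-[t^2-(x^2+y^2)^2]u_yu_t-u^2-tuu_y+2txuu_t-\tfrac14(x^3+ty+xy^2)u^4,$$ $$C_3=\tfrac12(t^2-x^4-4txy+2x^2y^2+3y^4)u_x^2+\tfrac12(t^2+3x^4+4txy+2x^2y^2-y^4)u_y^2-2(x^2+y^2)[t^2-(x^2+y^2)^2]u_t^2+2[t(x^2-y^2)-2xy(x^2+y^2)]u_xu_y+4(x^2+y^2)(x^2y-tx+y^3)u_xu_t-4(x^2+y^2)(x^3+ty+xy^2)u_yu_t+2txuu_y-2tyuu_x-4t(x^2+y^2)uu_t+2yu^2-\tfrac14[t^2-(x^2+y^2)^2]u^4.$$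
   Context: Coordinates on $\mathbb{R}^3$ (the underlying manifold of the Heisenberg group $\mathbb{H}$) are $(x,y,t)=(x^1,x^2,x^3)$; subscripts on $u$ denote partial derivatives, and $D_x,D_y,D_t$ (also $D_1,D_2,D_3$) are total derivatives. The Kohn-Laplace operator is $\Delta_{\mathbb{H}}=X^2+Y^2$ with $X=\partial_x+2y\partial_t$, $Y=\partial_y-2x\partial_t$, so that $\Delta_{\mathbb{H}}u=u_{xx}+u_{yy}+4(x^2+y^2)u_{tt}+4yu_{xt}-4xu_{yt}$. The critical equation $\Delta_{\mathbb{H}}u+u^3=0$ arises from the Lagrangian $$\mathcal{L}=\tfrac12u_x^2+\tfrac12u_y^2+2(x^2+y^2)u_t^2+2yu_xu_t-2xu_yu_t-\tfrac14u^4.$$ The symmetries are the following vector fields on $(x,y,t,u)$-space: - $T=\partial_t$, $\;R=y\partial_x-x\partial_y$, $\;\tilde X=\partial_x-2y\partial_t$, $\;\tilde Y=\partial_y+2x\partial_t$, - $Z=x\partial_x+y\partial_y+2t\partial_t-u\partial_u$, - $V_1=(xt-x^2y-y^3)\partial_x+(yt+x^3+xy^2)\partial_y+(t^2-(x^2+y^2)^2)\partial_t-tu\,\partial_u$, - $V_2=(t-4xy)\partial_x+(3x^2-y^2)\partial_y-(2yt+2x^3+2xy^2)\partial_t+2yu\,\partial_u$, - $V_3=(x^2-3y^2)\partial_x+(t+4xy)\partial_y+(2xt-2x^2y-2y^3)\partial_t-2xu\,\partial_u$. A vector field $S=\xi^i\partial_{x^i}+\eta\,\partial_u$ with first prolongation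 $S^{(1)}$ is a divergence symmetry with potential $\varphi=(\varphi^1,\varphi^2,\varphi^3)$ if $S^{(1)}\mathcal{L}+\mathcal{L}D_i\xi^i=D_i\varphi^i$ (summation over repeated indices); it is variational if $\varphi=0$. Noether symmetries are the variational or divergence symmetries. For such a symmetry, Noether's theorem gives the conservation law $D_i\big(\xi^i\mathcal{L}+W^i-\varphi^i\big)=0$ for all solutions $u$, where for this first-order Lagrangian $W^i=(\eta-\xi^ju_j)\,\partial\mathcal{L}/\partial u_i$ with $u_i=\partial u/\partial x^i$. The symmetries $T,R,\tilde X,\tilde Y,Z$ are variational, and $V_1,V_2,V_3$ are divergence symmetries with potentials $(-yu^2,\,xu^2,\,-2(x^2+y^2)u^2)$, $(0,\,u^2,\,-2xu^2)$ and $(-u^2,\,0,\,-2yu^2)$ respectively.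
   Formalization: In item 8 the printed C (a near copy of A) is not conserved: for u=2((1+x²+y²)²+t²)^(-1/2), Div(C)=2 at (0,1,0). The formal statement replaces C by the current Noether's formula gives for V_3 with potential (-u², 0, -2yu²), written out explicitly. *)

(* Defs.v *)
From Stdlib Require Export Reals.
From Coquelicot Require Export Coquelicot.

Open Scope R_scope.

Inductive coord := cx | cy | ct.

Definition coord_eq_dec (i j : coord) : {i = j} + {i <> j}.
Proof. decide equality. Defined.

(* R^3 is [coord -> R] with Coquelicot's sup-distance uniform structure, so
   that [open] and [continuous] below have their usual meaning. *)
Notation R3 := (coord -> R).

Definition sum3 (f : coord -> R) : R := f cx + f cy + f ct.

Definition triple {A : Type} (a b c : A) (i : coord) : A :=
  match i with cx => a | cy => b | ct => c end.

Definition upd (q : R3) (i : coord) (s : R) : R3 :=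
  fun j => if coord_eq_dec j i then s else q j.

Definition pd (i : coord) (f : R3 -> R) (q : R3) : R :=
  Derive (fun s => f (upd q i s)) (q i).

Definition ex_pd (i : coord) (f : R3 -> R) (q : R3) : Prop :=
  ex_derive (fun s => f (upd q i s)) (q i).

Fixpoint Ck (n : nat) (Omega : R3 -> Prop) (f : R3 -> R) : Prop :=
  (forall q, Omega q -> continuous f q) /\
  match n with
  | O => True
  | S m => forall i,
      (forall q, Omega q -> ex_pd i f q) /\ Ck m Omega (pd i f)
  end.

(* [base_fun] is a function of (x, y, t, u); [jet_fun] a function of
   (x, y, t, u, u_x, u_y, u_t), the jet variables being independent. *)
Definition base_fun := R3 -> R -> R.
Definition jet_fun := R3 -> R -> R3 -> R.

Definition bfun (f : R -> R -> R -> R -> R) : base_fun :=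
  fun q u => f (q cx) (q cy) (q ct) u.

Definition jfun (F : R -> R -> R -> R -> R -> R -> R -> R) : jet_fun :=
  fun q u p => F (q cx) (q cy) (q ct) u (p cx) (p cy) (p ct).

Definition jet_dx (i : coord) (F : jet_fun) : jet_fun :=
  fun q u p => Derive (fun s => F (upd q i s) u p) (q i).
Definition jet_du (F : jet_fun) : jet_fun :=
  fun q u p => Derive (fun s => F q s p) u.
Definition jet_dp (i : coord) (F : jet_fun) : jet_fun :=
  fun q u p => Derive (fun s => F q u (upd p i s)) (p i).

(* D_i f = f_{x^i} + u_i f_u *)
Definition total_D (i : coord) (f : base_fun) : jet_fun :=
  fun q u p =>
    Derive (fun s => f (upd q i s) u) (q i) + p i * Derive (fun s => f q s) u.

(* xi^i d/dx^i + eta d/du *)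
Record vfield := VField { xi : coord -> base_fun; eta : base_fun }.

Definition vf (a b c e : R -> R -> R -> R -> R) : vfield :=
  VField (triple (bfun a) (bfun b) (bfun c)) (bfun e).

Definition potential (a b c : R -> R -> R -> R -> R) : coord -> base_fun :=
  triple (bfun a) (bfun b) (bfun c).

Definition no_potential : coord -> base_fun := fun _ _ _ => 0.

(* Coefficient of d/du_i in the first prolongation:
   D_i eta - u_j D_i xi^j. *)
Definition eta1 (S : vfield) (i : coord) : jet_fun :=
  fun q u p =>
    total_D i (eta S) q u p - sum3 (fun j => p j * total_D i (xi S j) q u p).

Definition prolong1 (S : vfield) (F : jet_fun) : jet_fun :=
  fun q u p =>
    sum3 (fun i => xi S i q u * jet_dx i F q u p)
    + eta S q u * jet_du F q u p
    + sum3 (fun i => eta1 S i q u p * jet_dp i F q u p).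

Definition divergence_symmetry
    (L : jet_fun) (S : vfield) (phi : coord -> base_fun) : Prop :=
  forall q u p,
    prolong1 S L q u p + L q u p * sum3 (fun i => total_D i (xi S i) q u p)
    = sum3 (fun i => total_D i (phi i) q u p).

(* xi^i L + W^i - phi^i with W^i = (eta - xi^j u_j) dL/du_i *)
Definition noether_current
    (L : jet_fun) (S : vfield) (phi : coord -> base_fun) (i : coord) : jet_fun :=
  fun q u p =>
    xi S i q u * L q u p
    + (eta S q u - sum3 (fun j => xi S j q u * p j)) * jet_dp i L q u p
    - phi i q u.

Definition current (F1 F2 F3 : R -> R -> R -> R -> R -> R -> R -> R)
  : coord -> jet_fun := triple (jfun F1) (jfun F2) (jfun F3).

(* F evaluated along the 1-jet of u; total derivatives of F along u are the
   partial derivatives of this function. *)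
Definition along (u : R3 -> R) (F : jet_fun) : R3 -> R :=
  fun q => F q (u q) (fun i => pd i u q).

Definition Div (u : R3 -> R) (P : coord -> jet_fun) (q : R3) : R :=
  sum3 (fun i => pd i (along u (P i)) q).

Definition KL_lagrangian : jet_fun :=
  jfun (fun x y t u ux uy ut =>
    1/2 * ux^2 + 1/2 * uy^2 + 2 * (x^2 + y^2) * ut^2
    + 2 * y * ux * ut - 2 * x * uy * ut - 1/4 * u^4).

Definition KL_equation (u : R3 -> R) (q : R3) : Prop :=
  let x := q cx in
  let y := q cy in
  pd cx (pd cx u) q + pd cy (pd cy u) q
  + 4 * (x^2 + y^2) * pd ct (pd ct u) q
  + 4 * y * pd ct (pd cx u) q - 4 * x * pd ct (pd cy u) q
  + (u q)^3 = 0.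

(* Classical (C^2) solution on an open subset of R^3. *)
Definition KL_solution (Omega : R3 -> Prop) (u : R3 -> R) : Prop :=
  open Omega /\ Ck 2 Omega u /\ forall q, Omega q -> KL_equation u q.

(* P is the Noether current of the divergence symmetry S with potential phi,
   and Div P = 0 holds for every solution. *)
Definition noether_conservation_law
    (S : vfield) (phi : coord -> base_fun) (P : coord -> jet_fun) : Prop :=
  divergence_symmetry KL_lagrangian S phi /\
  (forall i q u p, noether_current KL_lagrangian S phi i q u p = P i q u p) /\
  (forall Omega u, KL_solution Omega u ->
     forall q, Omega q -> Div u P q = 0).

Definition sym_T : vfield :=
  vf (fun x y t u => 0) (fun x y t u => 0) (fun x y t u => 1)
     (fun x y t u => 0).

Definition sym_R : vfield :=
  vf (fun x y t u => y) (fun x y t u => - x) (fun x y t u => 0)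
     (fun x y t u => 0).

Definition sym_Xtilde : vfield :=
  vf (fun x y t u => 1) (fun x y t u => 0) (fun x y t u => - (2 * y))
     (fun x y t u => 0).

Definition sym_Ytilde : vfield :=
  vf (fun x y t u => 0) (fun x y t u => 1) (fun x y t u => 2 * x)
     (fun x y t u => 0).

Definition sym_Z : vfield :=
  vf (fun x y t u => x) (fun x y t u => y) (fun x y t u => 2 * t)
     (fun x y t u => - u).

Definition sym_V1 : vfield :=
  vf (fun x y t u => x * t - x^2 * y - y^3)
     (fun x y t u => y * t + x^3 + x * y^2)
     (fun x y t u => t^2 - (x^2 + y^2)^2)
     (fun x y t u => - (t * u)).

Definition sym_V2 : vfield :=
  vf (fun x y t u => t - 4 * x * y)
     (fun x y t u => 3 * x^2 - y^2)
     (fun x y t u => - (2 * y * t + 2 * x^3 + 2 * x * y^2))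
     (fun x y t u => 2 * y * u).

Definition sym_V3 : vfield :=
  vf (fun x y t u => x^2 - 3 * y^2)
     (fun x y t u => t + 4 * x * y)
     (fun x y t u => 2 * x * t - 2 * x^2 * y - 2 * y^3)
     (fun x y t u => - (2 * x * u)).

Definition pot_V1 : coord -> base_fun :=
  potential (fun x y t u => - (y * u^2)) (fun x y t u => x * u^2)
            (fun x y t u => - (2 * (x^2 + y^2) * u^2)).

Definition pot_V2 : coord -> base_fun :=
  potential (fun x y t u => 0) (fun x y t u => u^2)
            (fun x y t u => - (2 * x * u^2)).

Definition pot_V3 : coord -> base_fun :=
  potential (fun x y t u => - u^2) (fun x y t u => 0)
            (fun x y t u => - (2 * y * u^2)).

(* Main.v *)
From Stdlib Require Import FunctionalExtensionality Lra.
Require Import Defs.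

(** The eight conservation laws are instances of one identity, due to Noether.
    Write p^i = dL/du_i for the momenta, Q = eta - xi^j u_j for the
    characteristic of S, and E(L) = dL/du - D_i p^i for the Euler-Lagrange
    expression.  Expanding by the product and chain rules, and exchanging the
    mixed second derivatives of u, gives for every C^2 function u

      D_i (xi^i L + Q p^i - phi^i)
        = (S^(1) L + L D_i xi^i - D_i phi^i) - Q E(L).

    The bracket vanishes when S is a divergence symmetry with potential phi,
    and E(L) vanishes on solutions, since for the Kohn-Laplace
    Lagrangian E(L) is minus the left-hand side of the critical equation.  So
    the current of any divergence symmetry is conserved
    ([noether_identity], [euler_lagrange_KL], [conservation_law_of_symmetry]).

    Two facts from analysis enter.  The exchange of mixed derivatives is the
    theorem of Schwarz on the coordinate planes through a point ([pd_comm]).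
    The total derivatives of L, p^i, xi^i, eta, phi^i along u require the
    multivariate chain rule for these functions; it is carried as the
    hypothesis [chain_rule], which for polynomials reduces to one-variable
    differentiation.

    What remains for each vector field is that it satisfies the symmetry
    condition and that its Noether current is the stated triple: polynomial
    identities in the jet variables. *)

(** * Coordinate slices and symmetry of second derivatives *)

Lemma upd_same q i s : upd q i s i = s.
Proof. unfold upd. destruct (coord_eq_dec i i); congruence. Qed.

Lemma upd_self q i : upd q i (q i) = q.
Proof.
  apply functional_extensionality; intros j; unfold upd.
  destruct (coord_eq_dec j i); congruence.
Qed.

Lemma upd_upd q i s r : upd (upd q i s) i r = upd q i r.
Proof.
  apply functional_extensionality; intros k; unfold upd.
  destruct (coord_eq_dec k i); congruence.
Qed.

Lemma upd_comm q i j s r : i <> j -> upd (upd q i s) j r = upd (upd q j r) i s.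
Proof.
  intros ij; apply functional_extensionality; intros k; unfold upd.
  destruct (coord_eq_dec k j), (coord_eq_dec k i); congruence.
Qed.

Lemma is_derive_pd i f q :
  ex_pd i f q -> is_derive (fun s => f (upd q i s)) (q i) (pd i f q).
Proof. apply Derive_correct. Qed.

(** For i <> j the map (a, b) |-> [upd (upd q i a) j b] parametrizes the
    coordinate plane through q and is non-expanding for the sup-distance, so
    neighbourhoods of q pull back to neighbourhoods of (q i, q j). *)
Lemma locally_2d_upd (P : R3 -> Prop) q i j :
  locally q P -> locally_2d (fun a b => P (upd (upd q i a) j b)) (q i) (q j).
Proof.
  intros [d Hd]. exists d. intros a b Ha Hb. apply Hd. intros k.
  unfold upd.
  destruct (coord_eq_dec k j) as [->|]; [exact Hb|].
  destruct (coord_eq_dec k i) as [->|]; [exact Ha|].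
  apply ball_center.
Qed.

Lemma continuity_2d_pt_upd (f : R3 -> R) q i j :
  continuous f q ->
  continuity_2d_pt (fun a b => f (upd (upd q i a) j b)) (q i) (q j).
Proof.
  intros Hf eps. rewrite !upd_self.
  apply (locally_2d_upd (fun z => Rabs (f z - f q) < eps)).
  exact (Hf _ (locally_ball (f q) eps)).
Qed.

(** [ex_pd] and [pd] differentiate at the base point; these two lemmas move them
    to an arbitrary parameter of the same coordinate line. *)
Lemma ex_pd_slice i f q s :
  ex_pd i f (upd q i s) -> ex_derive (fun r => f (upd q i r)) s.
Proof.
  unfold ex_pd. rewrite upd_same.
  apply ex_derive_ext. intros r. now rewrite upd_upd.
Qed.

Lemma Derive_slice i f q s :
  Derive (fun r => f (upd q i r)) s = pd i f (upd q i s).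
Proof.
  unfold pd. rewrite upd_same.
  apply Derive_ext. intros r. now rewrite upd_upd.
Qed.

(** Schwarz's theorem applied to u restricted to the (i, j)-plane through q,
    whose iterated one-variable derivatives are the restrictions of the partial
    derivatives of u. *)
Lemma pd_comm Omega u q i j :
  open Omega -> Ck 2 Omega u -> Omega q -> pd i (pd j u) q = pd j (pd i u) q.
Proof.
  intros HO [_ Hu] Hq.
  destruct (coord_eq_dec i j) as [->|ij]; [reflexivity|].
  set (f a b := u (upd (upd q i a) j b)).
  assert (f_sym : forall a b, f a b = u (upd (upd q j b) i a)).
  { intros a b. unfold f. now rewrite upd_comm. }
  assert (Dj : forall a b, Derive (fun t => f a t) b
                           = pd j u (upd (upd q i a) j b)).
  { intros a b. apply (Derive_slice j u). }
  assert (Di : forall a b, Derive (fun t => f t b) a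
                           = pd i u (upd (upd q i a) j b)).
  { intros a b. rewrite upd_comm by exact ij. rewrite <- (Derive_slice i u).
    apply Derive_ext. intros t. apply f_sym. }
  assert (Dij : forall a b, Derive (fun z => Derive (fun t => f z t) b) a
                            = pd i (pd j u) (upd (upd q i a) j b)).
  { intros a b. rewrite upd_comm by exact ij. rewrite <- (Derive_slice i (pd j u)).
    apply Derive_ext. intros t. now rewrite Dj, upd_comm. }
  assert (Dji : forall a b, Derive (fun z => Derive (fun t => f t z) a) b
                            = pd j (pd i u) (upd (upd q i a) j b)).
  { intros a b. rewrite <- (Derive_slice j (pd i u)).
    apply Derive_ext. intros t. apply Di. }
  assert (Hs : Derive (fun z => Derive (fun t => f z t) (q j)) (q i)
             = Derive (fun z => Derive (fun t => f t z) (q i)) (q j)).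
  { apply Schwarz.
    - assert (HP := locally_2d_upd Omega q i j (HO q Hq)).
      revert HP. apply locally_2d_impl, locally_2d_forall.
      intros a b Hab.
      pose proof (Hab) as Hba. rewrite upd_comm in Hba by exact ij.
      repeat split.
      + apply ex_derive_ext with (fun z => u (upd (upd q j b) i z)).
        { intros z. now rewrite f_sym. }
        apply ex_pd_slice. exact (proj1 (Hu i) _ Hba).
      + apply (ex_pd_slice j u). exact (proj1 (Hu j) _ Hab).
      + apply ex_derive_ext with (fun z => pd j u (upd (upd q j b) i z)).
        { intros z. now rewrite Dj, upd_comm. }
        apply ex_pd_slice. exact (proj1 (proj2 (proj2 (Hu j)) i) _ Hba).
      + apply ex_derive_ext with (fun z => pd i u (upd (upd q i a) j z)).
        { intros z. now rewrite Di. }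
        apply ex_pd_slice. exact (proj1 (proj2 (proj2 (Hu i)) j) _ Hab).
    - apply continuity_2d_pt_ext with
        (fun a b => pd i (pd j u) (upd (upd q i a) j b)).
      { intros a b. now rewrite Dij. }
      apply continuity_2d_pt_upd.
      exact (proj1 (proj2 (proj2 (proj2 (Hu j)) i)) _ Hq).
    - apply continuity_2d_pt_ext with
        (fun a b => pd j (pd i u) (upd (upd q i a) j b)).
      { intros a b. now rewrite Dji. }
      apply continuity_2d_pt_upd.
      exact (proj1 (proj2 (proj2 (proj2 (Hu i)) j)) _ Hq). }
  rewrite Dij, Dji in Hs. now rewrite !upd_self in Hs.
Qed.

(** * Total derivatives along a function *)

Definition jet_of_base (f : base_fun) : jet_fun := fun q u _ => f q u.

(** The chain rule for F along any differentiable curve over a coordinate line.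
    Taking u and its gradient as the curve yields D_i F.  For a general F it is
    a regularity hypothesis, because [jet_dx], [jet_du] and [jet_dp] are
    only partial derivatives. *)
Definition chain_rule (F : jet_fun) : Prop :=
  forall i q (g : R -> R) (h : coord -> R -> R) (g' : R) (h' : R3),
    is_derive g (q i) g' ->
    (forall j, is_derive (h j) (q i) (h' j)) ->
    let v := g (q i) in
    let p := fun j => h j (q i) in
    is_derive (fun s => F (upd q i s) (g s) (fun j => h j s)) (q i)
      (jet_dx i F q v p + g' * jet_du F q v p
       + sum3 (fun j => h' j * jet_dp j F q v p)).

Lemma is_derive_along F Omega u q i :
  chain_rule F -> Ck 2 Omega u -> Omega q ->
  is_derive (fun s => along u F (upd q i s)) (q i)
    (along u (jet_dx i F) q + pd i u q * along u (jet_du F) q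
     + sum3 (fun j => pd i (pd j u) q * along u (jet_dp j F) q)).
Proof.
  intros HF [_ Hu] Hq.
  assert (H := HF i q (fun s => u (upd q i s)) (fun j s => pd j u (upd q i s))
                (pd i u q) (fun j => pd i (pd j u) q)).
  cbv zeta beta in H. rewrite upd_self in H.
  apply H.
  - apply is_derive_pd. exact (proj1 (Hu i) _ Hq).
  - intros j. apply (is_derive_pd i (pd j u)).
    exact (proj1 (proj2 (proj2 (Hu j)) i) _ Hq).
Qed.

Lemma pd_along F Omega u q i :
  chain_rule F -> Ck 2 Omega u -> Omega q ->
  pd i (along u F) q
  = along u (jet_dx i F) q + pd i u q * along u (jet_du F) q
    + sum3 (fun j => pd i (pd j u) q * along u (jet_dp j F) q).
Proof. intros. apply is_derive_unique. now apply is_derive_along with Omega. Qed.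

Lemma is_derive_along_base f Omega u q i :
  chain_rule (jet_of_base f) -> Ck 2 Omega u -> Omega q ->
  is_derive (fun s => f (upd q i s) (u (upd q i s))) (q i)
    (along u (total_D i f) q).
Proof.
  intros Hf Hu Hq.
  assert (H := is_derive_along _ _ _ q i Hf Hu Hq).
  replace (along u (total_D i f) q) with
    (along u (jet_dx i (jet_of_base f)) q
     + pd i u q * along u (jet_du (jet_of_base f)) q
     + sum3 (fun j => pd i (pd j u) q * along u (jet_dp j (jet_of_base f)) q)).
  { exact H. }
  unfold sum3, along, jet_dp, jet_of_base. rewrite !Derive_const.
  unfold total_D, jet_dx, jet_du. ring.
Qed.

(** * Noether's identity *)

Definition euler_lagrange (L : jet_fun) (u : R3 -> R) (q : R3) : R :=
  along u (jet_du L) q - sum3 (fun i => pd i (along u (jet_dp i L)) q).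

Definition characteristic (S : vfield) : jet_fun :=
  fun q u p => eta S q u - sum3 (fun j => xi S j q u * p j).

(* The eta-expanded form is the one that [auto_derive] produces. *)
Ltac rewrite_known_derivatives :=
  repeat match goal with H : @is_derive _ _ ?g ?x ?d |- _ =>
    replace (Derive (fun z => g z) x) with d
      by (symmetry; exact (is_derive_unique g x d H)); clear H
  end.

(** Product rule for the shape a l + (e - k.p) m - f of a Noether current along
    a coordinate line, with all factors abstract. *)
Lemma is_derive_current (a l e m f k1 k2 k3 p1 p2 p3 : R -> R)
    (a' l' e' m' f' k1' k2' k3' p1' p2' p3' x : R) :
  is_derive a x a' -> is_derive l x l' -> is_derive e x e' ->
  is_derive m x m' -> is_derive f x f' ->
  is_derive k1 x k1' -> is_derive k2 x k2' -> is_derive k3 x k3' ->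
  is_derive p1 x p1' -> is_derive p2 x p2' -> is_derive p3 x p3' ->
  is_derive
    (fun s => a s * l s
              + (e s - (k1 s * p1 s + k2 s * p2 s + k3 s * p3 s)) * m s - f s) x
    (a' * l x + a x * l'
     + (e' - (k1' * p1 x + k1 x * p1' + (k2' * p2 x + k2 x * p2')
              + (k3' * p3 x + k3 x * p3'))) * m x
     + (e x - (k1 x * p1 x + k2 x * p2 x + k3 x * p3 x)) * m' - f').
Proof.
  intros. auto_derive.
  { repeat split; eexists; eassumption. }
  rewrite_known_derivatives. ring.
Qed.

(** After differentiating the current, the terms xi^i u_ij p^j from D_i L and
    xi^j u_ij p^i from D_i Q cancel because u_ij = u_ji; what is left is the
    symmetry condition minus Q E(L). *)
Theorem noether_identity L S phi Omega u q :
  chain_rule L -> (forall i, chain_rule (jet_dp i L)) ->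
  (forall i, chain_rule (jet_of_base (xi S i))) ->
  chain_rule (jet_of_base (eta S)) ->
  (forall i, chain_rule (jet_of_base (phi i))) ->
  divergence_symmetry L S phi ->
  open Omega -> Ck 2 Omega u -> Omega q ->
  Div u (noether_current L S phi) q
  = - along u (characteristic S) q * euler_lagrange L u q.
Proof.
  intros HL Hm Hxi Heta Hphi Hsym HO Hu Hq.
  assert (D : forall i, pd i (along u (noether_current L S phi i)) q =
    along u (total_D i (xi S i)) q * along u L q
    + xi S i q (u q) * (along u (jet_dx i L) q + pd i u q * along u (jet_du L) q
       + sum3 (fun j => pd i (pd j u) q * along u (jet_dp j L) q))
    + (along u (total_D i (eta S)) q
       - sum3 (fun j => along u (total_D i (xi S j)) q * pd j u q
                        + xi S j q (u q) * pd i (pd j u) q))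
      * along u (jet_dp i L) q
    + along u (characteristic S) q * pd i (along u (jet_dp i L)) q
    - along u (total_D i (phi i)) q).
  { intros i. apply is_derive_unique.
    assert (Hu' := proj2 Hu).
    assert (HmD : is_derive (fun s => along u (jet_dp i L) (upd q i s)) (q i)
                    (pd i (along u (jet_dp i L)) q)).
    { apply is_derive_pd. eexists. now apply (is_derive_along _ Omega). }
    assert (Hp : forall j, is_derive (fun s => pd j u (upd q i s)) (q i)
                    (pd i (pd j u) q)).
    { intros j. apply is_derive_pd.
      exact (proj1 (proj2 (proj2 (Hu' j)) i) _ Hq). }
    pose proof (is_derive_current _ _ _ _ _ _ _ _ _ _ _ _ _ _ _ _ _ _ _ _ _ _ _
      (is_derive_along_base _ _ _ _ i (Hxi i) Hu Hq)
      (is_derive_along _ _ _ _ i HL Hu Hq)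
      (is_derive_along_base _ _ _ _ i Heta Hu Hq) HmD
      (is_derive_along_base _ _ _ _ i (Hphi i) Hu Hq)
      (is_derive_along_base _ _ _ _ i (Hxi cx) Hu Hq)
      (is_derive_along_base _ _ _ _ i (Hxi cy) Hu Hq)
      (is_derive_along_base _ _ _ _ i (Hxi ct) Hu Hq)
      (Hp cx) (Hp cy) (Hp ct)) as H.
    cbv beta in H. rewrite !upd_self in H.
    unfold sum3 in H |- *.
    exact H. }
  unfold Div. unfold sum3 at 1. rewrite !D. clear D.
  specialize (Hsym q (u q) (fun i => pd i u q)).
  unfold euler_lagrange, characteristic, prolong1, eta1, along, sum3 in *.
  (* One representative of each mixed derivative, so that [ring] can cancel. *)
  rewrite (pd_comm Omega u q cy cx HO Hu Hq), (pd_comm Omega u q ct cx HO Hu Hq),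
    (pd_comm Omega u q ct cy HO Hu Hq).
  match type of Hsym with ?a = ?b =>
    match goal with |- _ = ?r =>
      transitivity (r + (a - b)); [ring | rewrite Hsym; ring]
    end
  end.
Qed.

(** * The Kohn-Laplace Lagrangian *)

(* The derivative is found by [auto_derive] itself, through the evar l. *)
Ltac derive_polynomial :=
  repeat match goal with |- context [Derive ?f ?x] =>
    let l := fresh "l" in let D := fresh "D" in
    evar (l : R);
    assert (D : is_derive f x l);
    [ unfold l; auto_derive; [exact I | reflexivity]
    | rewrite (is_derive_unique f x l D); unfold l; clear D l ]
  end.

(* Both sides are one-variable derivatives of explicit polynomials in the curve
   (g, h); the three components of h are made independent functions so that
   [auto_derive] treats them as such. *)
Ltac chain_rule_polynomial :=
  intros i q g h g' h' Hg Hh; cbv zeta;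
  pose proof (Hh cx) as Hx; pose proof (Hh cy) as Hy; pose proof (Hh ct) as Ht;
  unfold sum3; revert Hx Hy Ht;
  generalize (h' cx), (h' cy), (h' ct); intros dx dy dt;
  destruct i; unfold jet_of_base, jet_dx, jet_du, jet_dp; cbn -[IZR pow];
  unfold bfun, jfun; cbn -[IZR pow];
  generalize (h cx), (h cy), (h ct); intros hx hy ht Hx Hy Ht;
  derive_polynomial;
  (auto_derive;
   [ repeat split; eexists; eassumption | rewrite_known_derivatives; ring ]).

Lemma chain_rule_KL : chain_rule KL_lagrangian.
Proof. unfold KL_lagrangian. chain_rule_polynomial. Qed.

Definition KL_momentum : coord -> jet_fun :=
  current
    (fun x y t u ux uy ut => ux + 2 * y * ut)
    (fun x y t u ux uy ut => uy - 2 * x * ut)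
    (fun x y t u ux uy ut => 4 * (x^2 + y^2) * ut + 2 * y * ux - 2 * x * uy).

Lemma jet_dp_KL i : jet_dp i KL_lagrangian = KL_momentum i.
Proof.
  do 3 (apply functional_extensionality; intro).
  destruct i; unfold jet_dp, KL_lagrangian, KL_momentum, current, jfun;
    cbn -[IZR pow]; derive_polynomial; field.
Qed.

Lemma chain_rule_KL_momentum i : chain_rule (KL_momentum i).
Proof. unfold KL_momentum. destruct i; chain_rule_polynomial. Qed.

(** E(L) = - (Delta_H u + u^3): the cross terms 2y u_x u_t and -2x u_y u_t of L
    contribute to two momenta each, which accounts for the coefficients 4y and
    -4x of the equation once mixed derivatives are exchanged. *)
Lemma euler_lagrange_KL Omega u q :
  KL_solution Omega u -> Omega q -> euler_lagrange KL_lagrangian u q = 0.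
Proof.
  intros [HO [Hu Heq]] Hq.
  specialize (Heq q Hq). unfold KL_equation in Heq.
  unfold euler_lagrange, sum3. rewrite !jet_dp_KL.
  rewrite !(pd_along _ Omega) by auto using chain_rule_KL_momentum.
  unfold along, sum3, jet_dx, jet_du, jet_dp, KL_lagrangian, KL_momentum,
    current, jfun. cbn -[IZR pow]. derive_polynomial.
  rewrite (pd_comm Omega u q cx ct HO Hu Hq), (pd_comm Omega u q cy ct HO Hu Hq).
  cbv zeta in Heq. lra.
Qed.

(** * Conservation laws of the Noether symmetries *)

(** Reduces a conservation law to pointwise identities on jet space: the
    analytic clause follows from Noether's identity and the vanishing of
    E(L) on solutions. *)
Lemma conservation_law_of_symmetry S phi P :
  (forall i, chain_rule (jet_of_base (xi S i))) ->
  chain_rule (jet_of_base (eta S)) ->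
  (forall i, chain_rule (jet_of_base (phi i))) ->
  divergence_symmetry KL_lagrangian S phi ->
  (forall i q u p, noether_current KL_lagrangian S phi i q u p = P i q u p) ->
  noether_conservation_law S phi P.
Proof.
  intros Hxi Heta Hphi Hsym HP. split; [exact Hsym | split; [exact HP |]].
  intros Omega u Hsol q Hq.
  transitivity (Div u (noether_current KL_lagrangian S phi) q).
  { unfold Div, sum3, pd, along.
    f_equal; [f_equal|]; apply Derive_ext; intros s; symmetry; apply HP. }
  rewrite (noether_identity KL_lagrangian S phi Omega);
    try assumption; try apply Hsol.
  - rewrite (euler_lagrange_KL Omega u q Hsol Hq). ring.
  - apply chain_rule_KL.
  - intros i. rewrite jet_dp_KL. apply chain_rule_KL_momentum.
Qed.

Ltac conservation_law_polynomial :=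
  apply conservation_law_of_symmetry;
  [ intros []; chain_rule_polynomial
  | chain_rule_polynomial
  | intros []; chain_rule_polynomial
  | intros q u p;
    unfold prolong1, eta1, total_D, sum3; rewrite ?jet_dp_KL;
    unfold jet_dx, jet_du, KL_lagrangian;
    cbn -[IZR pow]; unfold bfun, jfun; cbn -[IZR pow];
    derive_polynomial; field
  | intros i q u p; unfold noether_current; rewrite jet_dp_KL;
    unfold KL_lagrangian; destruct i; unfold sum3;
    cbn -[IZR pow]; unfold bfun, jfun; cbn -[IZR pow]; field ].

Theorem theorem1 :
  noether_conservation_law sym_T no_potential (current
    (fun x y t u ux uy ut => - 2*y*ut^2 - ux*ut)
    (fun x y t u ux uy ut => 2*x*ut^2 - uy*ut)
    (fun x y t u ux uy ut =>
       1/2*ux^2 + 1/2*uy^2 - 2*(x^2+y^2)*ut^2 - 1/4*u^4))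
  /\
  noether_conservation_law sym_R no_potential (current
    (fun x y t u ux uy ut =>
       - (1/2)*y*ux^2 + 1/2*y*uy^2 + 2*y*(x^2+y^2)*ut^2 + x*ux*uy - 1/4*y*u^4)
    (fun x y t u ux uy ut =>
       - (1/2)*x*ux^2 + 1/2*x*uy^2 - 2*x*(x^2+y^2)*ut^2 - y*ux*uy + 1/4*x*u^4)
    (fun x y t u ux uy ut =>
       - 2*y^2*ux^2 - 2*x^2*uy^2 + 4*x*y*ux*uy
       - 4*y*(x^2+y^2)*ux*ut + 4*x*(x^2+y^2)*uy*ut))
  /\
  noether_conservation_law sym_Xtilde no_potential (current
    (fun x y t u ux uy ut =>
       - (1/2)*ux^2 + 1/2*uy^2 + 2*(x^2+3*y^2)*ut^2
       + 2*y*ux*ut - 2*x*uy*ut - 1/4*u^4)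
    (fun x y t u ux uy ut =>
       - 4*x*y*ut^2 - ux*uy + 2*x*ux*ut + 2*y*uy*ut)
    (fun x y t u ux uy ut =>
       - 3*y*ux^2 - y*uy^2 + 4*y*(x^2+y^2)*ut^2 + 2*x*ux*uy
       - 4*(x^2+y^2)*ux*ut + 1/2*y*u^4))
  /\
  noether_conservation_law sym_Ytilde no_potential (current
    (fun x y t u ux uy ut =>
       - 4*x*y*ut^2 - ux*uy - 2*x*ux*ut - 2*y*uy*ut)
    (fun x y t u ux uy ut =>
       1/2*ux^2 - 1/2*uy^2 + 2*(3*x^2+y^2)*ut^2
       + 2*y*ux*ut - 2*x*uy*ut - 1/4*u^4)
    (fun x y t u ux uy ut =>
       x*ux^2 + 3*x*uy^2 - 4*x*(x^2+y^2)*ut^2 - 2*y*ux*uy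
       - 4*(x^2+y^2)*uy*ut - 1/2*x*u^4))
  /\
  noether_conservation_law sym_Z no_potential (current
    (fun x y t u ux uy ut =>
       - (1/2)*x*ux^2 + 1/2*x*uy^2 + 2*(x^3-2*t*y+x*y^2)*ut^2 - y*ux*uy
       - 2*t*ux*ut - 2*(x^2+y^2)*uy*ut - u*ux - 2*y*u*ut - 1/4*x*u^4)
    (fun x y t u ux uy ut =>
       1/2*y*ux^2 - 1/2*y*uy^2 + 2*(2*t*x+x^2*y+y^3)*ut^2 - x*ux*uy
       + 2*(x^2+y^2)*ux*ut - 2*t*uy*ut - u*uy + 2*x*u*ut - 1/4*y*u^4)
    (fun x y t u ux uy ut =>
       (t-2*x*y)*ux^2 + (t+2*x*y)*uy^2 - 4*t*(x^2+y^2)*ut^2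
       + 2*(x^2-y^2)*ux*uy - 4*x*(x^2+y^2)*ux*ut - 4*y*(x^2+y^2)*uy*ut
       + 2*x*u*uy - 2*y*u*ux - 4*(x^2+y^2)*u*ut - 1/2*t*u^4))
  /\
  noether_conservation_law sym_V1 pot_V1 (current
    (fun x y t u ux uy ut =>
       - (1/2)*(t*x-x^2*y-y^3)*ux^2 + 1/2*(t*x-x^2*y-y^3)*uy^2
       + 2*t*(x^3+x*y^2-t*y)*ut^2 - (x^3+x*y^2+t*y)*ux*uy
       - (t^2-(x^2+y^2)^2)*ux*ut - 2*t*(x^2+y^2)*uy*ut
       - t*u*ux - 2*t*y*u*ut + y*u^2 - 1/4*(t*x-x^2*y-y^3)*u^4)
    (fun x y t u ux uy ut =>
       1/2*(x^3+t*y+x*y^2)*ux^2 - 1/2*(x^3+t*y+x*y^2)*uy^2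
       + 2*t*(x^2*y+y^3+t*x)*ut^2 - (t*x-x^2*y-y^3)*ux*uy
       + 2*t*(x^2+y^2)*ux*ut - (t^2-(x^2+y^2)^2)*uy*ut
       - t*u*uy + 2*t*x*u*ut - x*u^2 - 1/4*(x^3+t*y+x*y^2)*u^4)
    (fun x y t u ux uy ut =>
       1/2*(t^2-x^4-4*t*x*y+2*x^2*y^2+3*y^4)*ux^2
       + 1/2*(t^2+3*x^4+4*t*x*y+2*x^2*y^2-y^4)*uy^2
       - 2*(x^2+y^2)*(t^2-(x^2+y^2)^2)*ut^2
       + 2*(t*(x^2-y^2)-2*x*y*(x^2+y^2))*ux*uy
       - 4*(x^2+y^2)*(t*x-x^2*y-y^3)*ux*ut
       - 4*(x^2+y^2)*(x^3+t*y+x*y^2)*uy*ut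
       - 2*t*y*u*ux + 2*t*x*u*uy - 4*t*(x^2+y^2)*u*ut
       + 2*(x^2+y^2)*u^2 - 1/4*(t^2-(x^2+y^2)^2)*u^4))
  /\
  noether_conservation_law sym_V2 pot_V2 (current
    (fun x y t u ux uy ut =>
       - (1/2)*(t-4*x*y)*ux^2 + 1/2*(t-4*x*y)*uy^2
       + (2*t*(x^2+3*y^2)-4*x*y*(x^2+y^2))*ut^2 - (3*x^2-y^2)*ux*uy
       + 2*(x^3+t*y+x*y^2)*ux*ut - 2*(t*x-x^2*y-y^3)*uy*ut
       + 2*y*u*ux + 4*y^2*u*ut - 1/4*(t-4*x*y)*u^4)
    (fun x y t u ux uy ut =>
       1/2*(3*x^2-y^2)*ux^2 - 1/2*(3*x^2-y^2)*uy^2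
       + 2*(x^4-2*t*x*y-y^4)*ut^2 - (t-4*x*y)*ux*uy
       + 2*(t*x-x^2*y-y^3)*ux*ut + 2*(x^3+t*y+x*y^2)*uy*ut
       + 2*y*u*uy - 4*x*y*u*ut - u^2 - 1/4*(3*x^2-y^2)*u^4)
    (fun x y t u ux uy ut =>
       (7*x*y^2-x^3-3*t*y)*ux^2 + (5*x^3-3*x*y^2-t*y)*uy^2
       + 4*(x^2+y^2)*(x^3+t*y+x*y^2)*ut^2
       + 2*(t*x-7*x^2*y+y^3)*ux*uy - 4*(t-4*x*y)*(x^2+y^2)*ux*ut
       - 4*(3*x^4+2*x^2*y^2-y^4)*uy*ut
       + 2*x*u^2 + 4*y^2*u*ux - 4*x*y*u*uy + 8*y*(x^2+y^2)*u*ut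
       + 1/2*(x^3+t*y+x*y^2)*u^4))
  /\
  noether_conservation_law sym_V3 pot_V3 (current
    (fun x y t u ux uy ut =>
       - (1/2)*(x^2-3*y^2)*ux^2 + 1/2*(x^2-3*y^2)*uy^2
       + 2*(x^4-2*t*x*y-y^4)*ut^2 - (t+4*x*y)*ux*uy
       - 2*(t*x-x^2*y-y^3)*ux*ut - 2*(x^3+t*y+x*y^2)*uy*ut
       - 2*x*u*ux - 4*x*y*u*ut + u^2 - 1/4*(x^2-3*y^2)*u^4)
    (fun x y t u ux uy ut =>
       1/2*(t+4*x*y)*ux^2 - 1/2*(t+4*x*y)*uy^2
       + (2*t*(3*x^2+y^2)+4*x*y*(x^2+y^2))*ut^2 - (x^2-3*y^2)*ux*uy
       + 2*(x^3+t*y+x*y^2)*ux*ut - 2*(t*x-x^2*y-y^3)*uy*ut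
       - 2*x*u*uy + 4*x^2*u*ut - 1/4*(t+4*x*y)*u^4)
    (fun x y t u ux uy ut =>
       (t*x-3*x^2*y+5*y^3)*ux^2 + (3*t*x+7*x^2*y-y^3)*uy^2
       - 4*(x^2+y^2)*(t*x-x^2*y-y^3)*ut^2
       + 2*(x^3-7*x*y^2-t*y)*ux*uy - 4*(x^2+y^2)*(x^2-3*y^2)*ux*ut
       - 4*(x^2+y^2)*(t+4*x*y)*uy*ut
       + 2*y*u^2 - 4*x*y*u*ux + 4*x^2*u*uy - 8*x*(x^2+y^2)*u*ut
       - 1/2*(t*x-x^2*y-y^3)*u^4)).
Proof.
  unfold sym_T, sym_R, sym_Xtilde, sym_Ytilde, sym_Z, sym_V1, sym_V2, sym_V3,
    pot_V1, pot_V2, pot_V3, no_potential, vf, potential.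
  repeat match goal with |- _ /\ _ => split end;
    conservation_law_polynomial.
Qed.
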